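(* Let $(X,d,\mu,\mathcal{E},\mathcal{F})$ be a Dirichlet space satisfying the standing assumptions (A1)–(A3), (HK), (BE) stated in the context, and let $0<\delta<1$. Let $1\leq p<\infty$. Then $$\mathbf{B}^{p,1/p}(X)=\mathcal{W}^{\delta d_W/p,\,p}(X)$$ with equivalent norms (i.e. the seminorms $\|f\|_{p,1/p}$ and $W_{\delta d_W/p,p}(f)$ are comparable up to multiplicative constants independent of $f$).
   Context: Setting. $(X,d,\mu)$ is a locally compact metric measure space, $\mu$ a Radon measure supported on $X$, and $(\mathcal{E},\mathcal{F})$ is a Dirichlet form on $L^2(X,\mu)$ with heat semigroup $\{P_t\}_{t>0}$ and generator $L$. Write $B(x,r)=\{y: d(x,y)<r\}$. For $\lambda>0$, $1\le p<\infty$, $KS^{\lambda,p}(X)$ is the set of $f\in L^p(X,\mu)$ with $\limsup_{r\to0^+}\int_X\int_{B(x,r)}\frac{|f(x)-f(y)|^p}{r^{\lambda p}\mu(B(x,r))}d\mu(y)d\mu(x)<\infty$. Standing assumptions. (A1) Every ball $B(x,r)$ has compact closure. (A2) There are $c_1,c_2,d_H>0$ with $c_1r^{d_H}\le\mu(B(x,r))\le c_2r^{d_H}$ for all $x\in X$, $r\ge0$. (A3) $(\mathcal{E},\mathcal{F})$ is regular and strongly local. (HK) $\{P_t\}$ has a continuous heat kernel $p_t(x,y)$ and there are $c_3,c_4,c_5,c_6\in(0,\infty)$, $d_W\in[2,\infty)$ with $c_5t^{-d_H/d_W}\exp(-c_6(d(x,y)^{d_W}/t)^{1/(d_W-1)})\le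 p_t(x,y)\le c_3t^{-d_H/d_W}\exp(-c_4(d(x,y)^{d_W}/t)^{1/(d_W-1)})$ for $\mu\times\mu$-a.e. $(x,y)$ and every $t>0$. (BE) There is $C>0$ such that $|P_tg(x)-P_tg(y)|\le C\frac{d(x,y)^\kappa}{t^{\kappa/d_W}}\|g\|_{L^\infty(X,\mu)}$ for all $t>0$, $g\in L^\infty(X,\mu)$, $x,y\in X$, where $0<\kappa<d_W$ is defined by $d_W-\kappa=\sup\{\lambda>0: KS^{\lambda,1}(X)\text{ contains non-constant functions}\}$. Subordinated semigroup. For fixed $0<\delta<1$ let $\eta^{(\delta)}_t\ge0$ be the continuous function with $\int_0^\infty\eta^{(\delta)}_t(s)e^{-s\lambda}ds=e^{-t\lambda^\delta}$ for $\lambda>0$. The semigroup with generator given by the fractional Laplacian $(-L)^\delta$ is $P^{(\delta)}_tf=\int_0^\infty\eta^{(\delta)}_t(s)P_sf\,ds$, with heat kernel $p^{(\delta)}_t(x,y)=\int_0^\infty\eta^{(\delta)}_t(s)p_s(x,y)ds$. Besov classes. For $p\ge1$, $\alpha\ge0$: $\|f\|_{p,\alpha}=\sup_{t>0}t^{-\alpha}\left(\int_X\int_X|f(x)-f(y)|^pp^{(\delta)}_t(x,y)d\mu(x)d\mu(y)\right)^{1/p}$ and $\mathbf{B}^{p,\alpha}(X)=\{f\in L^p(X,\mu):\|f\|_{p,\alpha}<\infty\}$. Fractional Sobolev spaces. $W_{\lambda,p}(f)=\left(\int_X\int_X\frac{|f(x)-f(y)|^p}{d(x,y)^{d_H+\lambda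 p}}d\mu(y)d\mu(x)\right)^{1/p}$ and $\mathcal{W}^{\lambda,p}(X)=\{f\in L^p(X,\mu):W_{\lambda,p}(f)<\infty\}$. *)

(* Defs.v *)
From HB Require Import structures.
From mathcomp Require Import all_boot all_order all_algebra.
From mathcomp Require Import all_classical all_reals all_analysis.

Set Implicit Arguments.
Unset Strict Implicit.
Unset Printing Implicit Defensive.

Import Order.TTheory GRing.Theory Num.Theory.
Import numFieldNormedType.Exports.

Local Open Scope classical_set_scope.
Local Open Scope ring_scope.

(* Elements of L^p spaces are represented by functions X -> R that belong to
   [Lfun mu p]; equality of classes is equality mu-almost everywhere. *)

HB.mixin Record Metric_isBorel (R : realType) (d : measure_display) X
    & Metric R X & Measurable d X := {
  borel_measurableE : @measurable d X = <<s [set A : set X | open A] >>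
}.

#[short(type="borelMetricType")]
HB.structure Definition BorelMetric (R : realType) (d : measure_display) :=
  { X of Metric R X & Measurable d X & Metric_isBorel R d X }.

Section metric_measure.
Context {R : realType} {d : measure_display} {X : borelMetricType R d}.
Variable mu : {measure set X -> \bar R}.

Record is_radon : Prop := {
  radon_compact : forall K : set X, compact K -> (mu K < +oo)%E ;
  radon_outer : forall A : set X, measurable A ->
    mu A = ereal_inf [set mu U | U in [set U : set X | open U /\ A `<=` U]] ;
  radon_inner : forall U : set X, open U ->
    mu U = ereal_sup [set mu K | K in [set K : set X | compact K /\ K `<=` U]]
}.

Definition full_support : Prop :=
  forall U : set X, open U -> U !=set0 -> (0 < mu U)%E.

Definition balls_relatively_compact : Prop :=
  forall (x : X) (r : R), compact (closure (ball x r)).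

Definition ahlfors_regular (dH : R) : Prop :=
  exists c1 c2 : R, [/\ 0 < c1, 0 < c2 &
    forall (x : X) (r : R), 0 <= r ->
      ((c1 * r `^ dH)%:E <= mu (ball x r) <= (c2 * r `^ dH)%:E)%E].

Definition L2 : set (X -> R) := [set f | f \in Lfun mu 2%:E].

Definition L2norm (f : X -> R) : R := fine 'N[mu]_2%:E[EFin \o f]%E.

Definition L2inner (f g : X -> R) : R := Rintegral mu setT (f \* g).

Definition compact_continuous : set (X -> R) :=
  [set f | continuous f /\ compact (closure [set x | f x != 0])].

(* The support of the measure f mu: the complement of the largest open set on
   which f vanishes almost everywhere. *)
Definition ess_support (f : X -> R) : set X :=
  ~` \bigcup_(U in [set U | open U /\ f = cst 0 %[ae mu in U]]) U.

Definition ae_constant (f : X -> R) : Prop :=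
  exists c : R, f = cst c %[ae mu].

Section dirichlet.
Variables (F : set (X -> R)) (E : (X -> R) -> (X -> R) -> R).

Definition energy1 (f : X -> R) : R := E f f + L2inner f f.

Record is_dirichlet_form : Prop := {
  form_sub_L2 : F `<=` L2 ;
  form_ae : forall f g, F f -> L2 g -> f = g %[ae mu] ->
    F g /\ forall h, F h -> E f h = E g h ;
  form_linear : forall (a : R) f g, F f -> F g -> F (fun x => a * f x + g x) ;
  form_dense : forall f, L2 f -> forall e : R, 0 < e ->
    exists2 g, F g & L2norm (f \- g) < e ;
  form_bilinear : forall (a : R) f g h, F f -> F g -> F h ->
    E (fun x => a * f x + g x) h = a * E f h + E g h ;
  form_symmetric : forall f g, F f -> F g -> E f g = E g f ;
  form_nonneg : forall f, F f -> 0 <= E f f ;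
  form_closed : forall u : nat -> X -> R, (forall n, F (u n)) ->
    (forall e : R, 0 < e -> exists N : nat, forall m n,
      (N <= m)%N -> (N <= n)%N -> energy1 (u m \- u n) < e) ->
    exists2 v, F v & energy1 (u n \- v) @[n --> \oo] --> (0 : R) ;
  form_markov : forall f, F f ->
    let g := fun x => Num.min (Num.max (f x) 0) 1 in F g /\ E g g <= E f f
}.

Record is_regular : Prop := {
  regular_dense_F : forall f, F f -> forall e : R, 0 < e ->
    exists2 g, (F `&` compact_continuous) g & energy1 (f \- g) < e ;
  regular_dense_C : forall f, compact_continuous f -> forall e : R, 0 < e ->
    exists2 g, (F `&` compact_continuous) g & forall x, `|f x - g x| < e
}.

Definition is_strongly_local : Prop :=
  forall f g, F f -> F g ->
    compact (ess_support f) -> compact (ess_support g) ->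
    (exists (U : set X) (c : R),
      [/\ open U, ess_support f `<=` U & g = cst c %[ae mu in U]]) ->
    E f g = 0.

(* [is_generator f h] means that f is in the domain of the generator L of the
   form and that L f = h, with the sign convention E(f, g) = - <L f, g>. *)
Definition is_generator (f h : X -> R) : Prop :=
  [/\ F f, L2 h & forall g, F g -> E f g = - L2inner h g].

(* P is the strongly continuous semigroup of symmetric contractions on L^2
   whose infinitesimal generator is the generator of the form. *)
Record is_heat_semigroup (P : R -> (X -> R) -> X -> R) : Prop := {
  heat_L2 : forall (t : R) f, 0 < t -> L2 f -> L2 (P t f) ;
  heat_ae : forall (t : R) f g, 0 < t -> L2 f -> L2 g -> f = g %[ae mu] ->
    P t f = P t g %[ae mu] ;
  heat_linear : forall (t : R) (a : R) f g, 0 < t -> L2 f -> L2 g ->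
    P t (fun x => a * f x + g x) = (fun x => a * P t f x + P t g x) %[ae mu] ;
  heat_contraction : forall (t : R) f, 0 < t -> L2 f -> L2norm (P t f) <= L2norm f ;
  heat_symmetric : forall (t : R) f g, 0 < t -> L2 f -> L2 g ->
    L2inner (P t f) g = L2inner f (P t g) ;
  heat_semigroup : forall (s t : R) f, 0 < s -> 0 < t -> L2 f ->
    P (s + t) f = P s (P t f) %[ae mu] ;
  heat_continuous : forall f, L2 f ->
    L2norm (P t f \- f) @[t --> 0^'+] --> (0 : R) ;
  heat_generator : forall f h, L2 f -> L2 h ->
    (L2norm (fun x => t^-1 * (P t f x - f x) - h x) @[t --> 0^'+] --> (0 : R))
    <-> is_generator f h
}.

End dirichlet.

Section heat_kernel.
Variable pk : R -> X -> X -> R.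

Definition heat_kernel_op (t : R) (f : X -> R) (x : X) : R :=
  Rintegral mu setT (fun y => pk t x y * f y).

Definition is_continuous_heat_kernel (P : R -> (X -> R) -> X -> R) : Prop :=
  (forall t : R, 0 < t -> continuous (fun z : X * X => pk t z.1 z.2)) /\
  (forall (t : R) f, 0 < t -> L2 f -> P t f = heat_kernel_op t f %[ae mu]).

Definition sub_gaussian_profile (dH dW c c' t : R) (x y : X) : R :=
  c * t `^ (- (dH / dW)) *
  expR (- c' * (mdist x y `^ dW / t) `^ (dW - 1)^-1).

Definition sub_gaussian_bounds (dH dW : R) : Prop :=
  exists c3 c4 c5 c6 : R, [/\ 0 < c3, 0 < c4, 0 < c5 & 0 < c6] /\
    forall t : R, 0 < t -> \forall z \ae (mu \x mu)%E,
      sub_gaussian_profile dH dW c5 c6 t z.1 z.2 <= pk t z.1 z.2 /\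
      pk t z.1 z.2 <= sub_gaussian_profile dH dW c3 c4 t z.1 z.2.

(* On L^oo the semigroup is the one given by integration against the heat
   kernel, which is defined pointwise. *)
Definition weak_bakry_emery (dW kappa : R) : Prop :=
  exists2 C : R, 0 < C &
    forall (t : R) g x y, 0 < t -> g \in Lfun mu +oo%E ->
      `|heat_kernel_op t g x - heat_kernel_op t g y| <=
      C * (mdist x y `^ kappa / t `^ (kappa / dW)) *
      fine 'N[mu]_+oo[EFin \o g]%E.

End heat_kernel.

Definition KS_energy (lam p : R) (f : X -> R) (r : R) : \bar R :=
  (\int[mu]_x \int[mu]_(y in ball x r)
    (`|f x - f y| `^ p / (r `^ (lam * p) * fine (mu (ball x r))))%:E)%E.

Definition KS_space (lam p : R) : set (X -> R) :=
  [set f | f \in Lfun mu p%:E /\ (limf_esup (KS_energy lam p f) 0^'+ < +oo)%E].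

(* dW - kappa is the critical exponent; the supremum is taken in \bar R, so
   that the equality also asserts its finiteness. *)
Definition is_critical_kappa (dW kappa : R) : Prop :=
  [/\ 0 < kappa, kappa < dW &
    (dW - kappa)%:E = ereal_sup [set lam%:E | lam in
      [set lam : R | 0 < lam /\
        exists2 f, KS_space lam 1 f & ~ ae_constant f]]].

Definition subordinated_kernel (eta : R -> R -> R) (pk : R -> X -> X -> R)
    (t : R) (x y : X) : \bar R :=
  (\int[lebesgue_measure]_(s in `]0%R, +oo[%classic) (eta t s * pk s x y)%:E)%E.

Definition besov_seminorm (q : R -> X -> X -> \bar R) (p alpha : R)
    (f : X -> R) : \bar R :=
  ereal_sup [set ((t `^ (- alpha))%:E *
    (\int[mu]_y \int[mu]_x ((`|f x - f y| `^ p)%:E * q t x y)) `^ p^-1)%E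
    | t in [set t : R | 0 < t]].

Definition besov_space (q : R -> X -> X -> \bar R) (p alpha : R) :
    set (X -> R) :=
  [set f | f \in Lfun mu p%:E /\ (besov_seminorm q p alpha f < +oo)%E].

(* On the diagonal the integrand is 0, since x / 0 = 0 in a field. *)
Definition sobolev_seminorm (dH lam p : R) (f : X -> R) : \bar R :=
  ((\int[mu]_x \int[mu]_y
    (`|f x - f y| `^ p / mdist x y `^ (dH + lam * p))%:E) `^ p^-1)%E.

Definition sobolev_space (dH lam p : R) : set (X -> R) :=
  [set f | f \in Lfun mu p%:E /\ (sobolev_seminorm dH lam p f < +oo)%E].

End metric_measure.

(* eta t is the density of the delta-stable subordinator at time t. *)
Definition is_subordinator_density (R : realType) (delta : R)
    (eta : R -> R -> R) : Prop :=
  forall t : R, 0 < t ->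
    [/\ forall s : R, 0 < s -> {for s, continuous (eta t)},
        forall s : R, 0 < s -> 0 <= eta t s &
        forall lam : R, 0 < lam ->
          (\int[lebesgue_measure]_(s in `]0%R, +oo[%classic)
            (eta t s * expR (- (s * lam)))%:E)%E =
          (expR (- (t * lam `^ delta)))%:E].

(* Main.v *)
Require Import Defs.
From HB Require Import structures.
From mathcomp Require Import all_boot all_order all_algebra finmap.
From mathcomp Require Import all_classical all_reals all_analysis.
From mathcomp Require Import measurable_realfun ring lra.

(** The two seminorms are compared through the kernel: off the diagonal, with
    d = mdist x y, the subordinated kernel satisfies

      q t x y <= C t / d ^ (dH + delta dW)          for every t > 0,
      q t x y >= c t / d ^ (dH + delta dW)          for t <= tau0 d ^ (delta dW)

    ([subordinated_kernel_le], [subordinated_kernel_ge]).  The upper bound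
    gives at once t^-1 \int\int |f x - f y|^p q t x y <= C W(f)^p for every t,
    where W is the fractional Sobolev seminorm.  The lower bound gives the
    reverse inequality for the part of W(f)^p that is carried by the pairs with
    tau0 d ^ (delta dW) >= t; this part increases to W(f)^p as t decreases to 0,
    so monotone convergence concludes ([besov_seminorm_le],
    [besov_seminorm_ge]).

    The kernel bounds are obtained from the Laplace transform of the
    subordinator density alone.  Put D = d ^ dW and u = s / D.  The sub-Gaussian
    profile at time s is D ^ (- dH / dW) times a function h of u, namely
    h u = u ^ (- dH / dW) exp (- c u ^ (- 1 / (dW - 1))).  If h lies between
    multiples of two combinations of exponentials exp (- k u), then its integral
    against eta t lies between the same combinations of
    exp (- t (k / D) ^ delta) = exp (- tau k ^ delta), where tau = t D ^ (- delta).

    - From above, h u <= K (1 - exp (- u)), and 1 - exp (- tau) <= tau.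
    - From below, h u is at least a multiple of
      A exp (- u) - (1 + A) exp (- 2 u) + exp (- 4 u), whose coefficients add up
      to 0 and which is negative near u = 0 when A < 2.  With y = 2 ^ delta its
      integral against eta t is
      A exp (- tau) - (1 + A) exp (- tau y) + exp (- tau y ^ 2), which is
      (y - 1) (A - y) tau to first order in tau.  As delta < 1, there is room
      for A with y < A < 2.

    Since d > 0 fixes the scale D, the almost everywhere heat kernel estimates
    are first turned into estimates at every pair of distinct points, by
    continuity and full support ([sub_gaussian_bounds_off_diagonal]). *)

Import Order.TTheory GRing.Theory Num.Theory.
Import numFieldNormedType.Exports.

Local Open Scope classical_set_scope.
Local Open Scope ring_scope.

(** * Monotonicity of the integral of arbitrary nonnegative functions *)

Section integral_monotone.
Context d (T : measurableType d) (R : realType) (m : {measure set T -> \bar R}).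
Local Open Scope ereal_scope.

Import HBNNSimple.

(** The integral of a nonnegative function is a supremum over the simple
    functions below it, so it is monotone for arbitrary functions.  The heat
    kernel [pk s x y] is only known to be continuous in the space variables, and
    the iterated integrals of the subordinated kernel are compared with
    measurable ones in this way. *)
Lemma ge0_le_integral_nomeas (D : set T) (f g : T -> \bar R) :
  (forall x, D x -> 0 <= f x) -> (forall x, D x -> f x <= g x) ->
  \int[m]_(x in D) f x <= \int[m]_(x in D) g x.
Proof.
move=> f0 fg.
have g0 x : D x -> 0 <= g x by move=> Dx; exact: le_trans (f0 _ Dx) (fg _ Dx).
rewrite !ge0_integralE//; apply: le_ereal_sup => _ [h /= hf <-].
exists h => // x /=.
by apply: (le_trans (hf x)); exact: lee_restrict.
Qed.

End integral_monotone.

(** * Comparison of the sub-Gaussian profile with exponentials *)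

Section elementary_bounds.
Context {R : realType}.
Implicit Types a b c s u w A : R.

(** The sub-Gaussian profile in the scale-free time variable
    u = s / d(x, y) ^ dW; see [sub_gaussian_profileE]. *)
Definition stretched_profile a b c u : R :=
  u `^ (- a) * expR (- (c * u^-1 `^ b)).

Lemma stretched_profile_ge0 a b c u : 0 <= stretched_profile a b c u.
Proof. by rewrite mulr_ge0 ?powR_ge0 ?expR_ge0. Qed.

(** Since z <= exp z at z = c w / s, taking the power s gives
    (c w / s) ^ s <= exp (c w). *)
Lemma powR_expR_bounded s c w : 0 < s -> 0 < c -> 0 <= w ->
  w `^ s * expR (- (c * w)) <= (s / c) `^ s.
Proof.
move=> s0 c0 w0; rewrite expRN ler_pdivrMr ?expR_gt0//.
have -> : c * w = (w * c / s) * s by field; rewrite gt_eqF.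
rewrite expRM -powRM ?divr_ge0 ?expR_ge0 ?(ltW s0) ?(ltW c0)//.
rewrite ge0_ler_powR ?nnegrE ?(ltW s0) ?mulr_ge0 ?invr_ge0 ?expR_ge0//; try lra.
have h : w * c / s <= expR (w * c / s).
  by apply: le_trans (expR_ge1Dx _); lra.
have {1}-> : w = s / c * (w * c / s) by field; rewrite !gt_eqF.
by rewrite ler_pM2l// divr_gt0.
Qed.

Lemma onesub_expRN_ge u : 0 < u -> u / (1 + u) <= 1 - expR (- u).
Proof.
move=> u0; have h := expR_ge1Dx u.
have e0 := expR_gt0 u; rewrite expRN.
have : (expR u)^-1 <= (1 + u)^-1 by rewrite lef_pV2// posrE; lra.
have -> : u / (1 + u) = 1 - (1 + u)^-1 by field; lra.
lra.
Qed.

(** As u tends to 0 the stretched exponential beats every power of u, so the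
    profile is at most a multiple of u; for u >= 1 it is at most 1.  Both are
    controlled by 1 - exp (- u). *)
Lemma stretched_profile_le a b c : 0 < a -> 0 < b -> 0 < c ->
  exists2 K : R, 0 < K &
    forall u, 0 < u -> stretched_profile a b c u <= K * (1 - expR (- u)).
Proof.
(* With v = u^-1, the exponent s makes (v ^ b) ^ s equal to v ^ (a + 1), that
   is, u ^ (- a) / u. *)
move=> a0 b0 c0; set s := (a + 1) / b.
have s0 : 0 < s by rewrite divr_gt0//; lra.
pose M : R := (s / c) `^ s; have M0 : 0 < M by apply/powR_gt0/divr_gt0.
exists (2 * (1 + M)); first lra.
move=> u u0; apply: (@le_trans _ _ (2 * (1 + M) * (u / (1 + u)))); last first.
  by rewrite ler_wpM2l ?onesub_expRN_ge//; lra.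
have [u1|u1] := leP 1 u.
  apply: (@le_trans _ _ 1).
    rewrite /stretched_profile -[leRHS]mulr1 ler_pM ?powR_ge0 ?expR_ge0//.
      by rewrite -(powRr0 u) ler_powR//; lra.
    by rewrite -expR0 ler_expR oppr_le0 mulr_ge0 ?powR_ge0// ltW.
  have : 2^-1 <= u / (1 + u) by rewrite ler_pdivlMr; lra.
  set z := u / (1 + u) => hz; nra.
have hM : stretched_profile a b c u <= M * u.
  rewrite /stretched_profile; set v := u^-1.
  have v0 : 0 < v by rewrite invr_gt0.
  have := powR_expR_bounded s c (v `^ b) s0 c0 (powR_ge0 _ _).
  rewrite -powRrM /s mulrCA divff ?gt_eqF// mulr1 -/M.
  rewrite powRD; last by apply/implyP => _; rewrite gt_eqF.
  have -> : u `^ (- a) = v `^ a by rewrite /v -powR_inv1 ?(ltW u0)// -powRrM mulN1r.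
  by rewrite powRr1 ?(ltW v0)// -ler_pdivrMr// mulrAC.
apply: (le_trans hM).
have : u / 2 <= u / (1 + u) by rewrite ler_pM2l// lef_pV2 ?posrE; lra.
set z := u / (1 + u) => hz; nra.
Qed.

(** The exponents 1, 2, 4 become the powers 1, y, y ^ 2 of y = 2 ^ delta after
    subordination, so that the first-order term factors as
    (1 + A) y - A - y ^ 2 = (y - 1) (A - y).  The coefficients add up to 0, as
    they must for the integral against eta t to be of order t. *)
Definition laplace_test A u : R :=
  A * expR (- u) - (1 + A) * expR (- (2 * u)) + expR (- (4 * u)).

(** The factorization shows the sign: the test function is nonpositive where
    exp (- u) is so close to 1 that x + x ^ 2 >= A. *)
Lemma laplace_testE A u : let x := expR (- u) in
  laplace_test A u = x * (1 - x) * (A - x - x ^+ 2).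
Proof.
rewrite /= /laplace_test.
have -> : - (2 * u) = 2 * - u by ring.
have -> : - (4 * u) = 4 * - u by ring.
by rewrite !expRM_natl; ring.
Qed.

(** Where the test function is positive, u is bounded away from 0.  There the
    stretched exponential is bounded below, and exp (- u) decays faster than
    u ^ (- a). *)
Lemma laplace_test_le a b c A : 0 < a -> 0 < b -> 0 < c -> 1 < A < 2 ->
  exists2 K : R, 0 < K &
    forall u, 0 < u -> laplace_test A u <= K * stretched_profile a b c u.
Proof.
(* If x + x ^ 2 < A and x < 1, then 3 x - 1 < A, as t + t ^ 2 lies above its
   tangent 3 t - 1 at t = 1; with x >= 1 - u this gives u > (2 - A) / 3. *)
move=> a0 b0 c0 /andP[A1 A2]; pose u0 := (2 - A) / 3.
have u00 : 0 < u0 by rewrite /u0; lra.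
pose K : R := 2 * (a / 1) `^ a * expR (c * u0^-1 `^ b).
have K0 : 0 < K by rewrite /K !mulr_gt0 ?powR_gt0 ?expR_gt0 ?divr_gt0.
exists K => // u up; rewrite laplace_testE; set x := expR (- u).
have x0 : 0 < x by exact: expR_gt0.
have x1 : x < 1 by rewrite /x -expR0 ltr_expR; lra.
have hp := stretched_profile_ge0 a b c u.
have [Ax|Ax] := leP (A - x - x ^+ 2) 0.
  apply: (@le_trans _ _ 0); last by rewrite mulr_ge0// ltW.
  by rewrite mulr_ge0_le0// mulr_ge0//; lra.
have hx : 1 - u <= x by have := expR_ge1Dx (- u); rewrite -/x; lra.
have hu : u0 <= u by rewrite /u0; nra.
apply: (@le_trans _ _ (2 * x)); first nra.
have hb := powR_expR_bounded a 1 u a0 ltr01 (ltW up).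
rewrite mul1r -/x in hb.
have he : 1 <= expR (c * u0^-1 `^ b) * expR (- (c * u^-1 `^ b)).
  rewrite -expRD -expR0 ler_expR -mulrBr mulr_ge0 ?(ltW c0)// subr_ge0.
  by rewrite ge0_ler_powR ?nnegrE ?invr_ge0 ?(ltW b0) ?(ltW u00) ?(ltW up)// lef_pV2.
have ua : 0 < u `^ a by rewrite powR_gt0.
have hb' : x <= (a / 1) `^ a * u `^ (- a) by rewrite powRN ler_pdivlMr// mulrC.
have -> : K * stretched_profile a b c u = 2 * ((a / 1) `^ a * u `^ (- a)) *
   (expR (c * u0^-1 `^ b) * expR (- (c * u^-1 `^ b))).
  by rewrite /K /stretched_profile; ring.
rewrite -[leLHS]mulr1 ler_pM//; last by rewrite ler_pM2l.
by rewrite mulr_ge0// ltW.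
Qed.

(** Taylor expansion at tau = 0 of the integral of [laplace_test] against
    eta t. *)
Lemma laplace_test_exponents A y tau : 1 < y -> y < A -> A < 2 -> 0 <= tau ->
  tau * ((y - 1) * (A - y) - (1 + A) * y ^+ 2 * tau) <=
  A * expR (- tau) - (1 + A) * expR (- (tau * y)) + expR (- (tau * y ^+ 2)).
Proof.
move=> y1 yA A2 t0.
have e1 := expR_ge1Dx (- tau).
have e3 := expR_ge1Dx (- (tau * y ^+ 2)).
have ty : 0 <= tau * y by nra.
have e2 : expR (- (tau * y)) <= 1 - tau * y + (tau * y) ^+ 2.
  rewrite expRN; apply: (@le_trans _ _ (1 + tau * y)^-1).
    by rewrite lef_pV2 ?posrE ?expR_gt0 ?expR_ge1Dx//; lra.
  rewrite -div1r ler_pdivrMr; last lra.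
  move: ty; set z := tau * y => ty.
  have : 0 <= z ^+ 3 by rewrite exprn_ge0.
  have -> : (1 - z + z ^+ 2) * (1 + z) = 1 + z ^+ 3 by ring.
  lra.
have h1 : A * (1 - tau) <= A * expR (- tau) by rewrite ler_wpM2l//; lra.
have h2 : (1 + A) * expR (- (tau * y)) <= (1 + A) * (1 - tau * y + (tau * y) ^+ 2).
  by rewrite ler_wpM2l//; lra.
lra.
Qed.

End elementary_bounds.

(** * Integrals against the density of the stable subordinator *)

Section subordinator.
Context {R : realType} {delta t : R} {e : R -> R}.
Hypothesis t0 : 0 < t.
Hypothesis e_cont : forall s : R, 0 < s -> {for s, continuous e}.
Hypothesis e_ge0 : forall s : R, 0 < s -> 0 <= e s.
Hypothesis e_laplace : forall l : R, 0 < l ->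
  (\int[lebesgue_measure]_(s in `]0%R, +oo[%classic)
    (e s * expR (- (s * l)))%:E)%E = (expR (- (t * l `^ delta)))%:E.

Local Notation I := (`]0%R, +oo[%classic : set R).
Local Notation leb := (@lebesgue_measure R).

Let I_gt0 s : I s -> 0 < s.
Proof. by rewrite /= in_itv/= andbT. Qed.

Let e_meas : measurable_fun I e.
Proof.
apply: open_continuous_measurable_fun; first exact: interval_open.
by move=> s /set_mem /I_gt0; exact: e_cont.
Qed.

Let eM_meas (f : R -> R) : measurable_fun setT f ->
  measurable_fun I (fun s => (e s * f s)%:E).
Proof.
move=> mf; apply/measurable_EFinP; apply: measurable_funM => //.
exact: measurable_funTS.
Qed.

Let expR_meas (k : R) : measurable_fun [set: R] (fun s => expR (- (s * k))).
Proof.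
apply: continuous_measurable_fun => s; apply: continuous_comp; last exact: continuous_expR.
by apply: cvgN; apply: cvgM; [exact: cvg_id|exact: cvg_cst].
Qed.

(** Monotone convergence in the Laplace transform as its argument tends
    to 0. *)
Lemma subordinator_mass_le1 : (\int[leb]_(s in I) (e s)%:E <= 1)%E.
Proof.
pose g n s : \bar R := (e s * expR (- (s * n.+1%:R^-1)))%:E.
have -> : (\int[leb]_(s in I) (e s)%:E =
           \int[leb]_(s in I) limn (g ^~ s))%E.
  apply: eq_integral => s _; apply/esym/cvg_lim => //.
  apply: cvg_EFin; first exact: nearW.
  have hz : - (s * n.+1%:R^-1) @[n --> \oo] --> - (s * 0).
    by apply: cvgN; apply: cvgM; [exact: cvg_cst|exact: (@cvg_harmonic R)].
  have -> : e s = e s * expR (- (s * 0)) by rewrite mulr0 oppr0 expR0 mulr1.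
  apply: cvgM; first exact: cvg_cst.
  apply: (continuous_cvg _ _ hz); exact: continuous_expR.
rewrite monotone_convergence//.
- apply: lime_le.
    apply: ereal_nondecreasing_is_cvgn => m n mn.
    apply: ge0_le_integral_nomeas => s /I_gt0 s0.
      by rewrite lee_fin mulr_ge0 ?expR_ge0 ?e_ge0.
    rewrite lee_fin ler_wpM2l ?e_ge0// ler_expR lerN2 ler_pM2l//.
    by rewrite lef_pV2 ?posrE// ler_nat.
  apply: nearW => n; rewrite e_laplace//.
  by rewrite lee_fin -expR0 ler_expR oppr_le0 mulr_ge0 ?(ltW t0) ?powR_ge0.
- by move=> n; apply: eM_meas; exact: expR_meas.
- by move=> n s /I_gt0 s0; rewrite lee_fin mulr_ge0 ?expR_ge0 ?e_ge0.
- move=> s /I_gt0 s0 m n mn.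
  rewrite lee_fin ler_wpM2l ?e_ge0// ler_expR lerN2 ler_pM2l//.
  by rewrite lef_pV2 ?posrE// ler_nat.
Qed.

Variable D : R.
Hypothesis D0 : 0 < D.
Let tau := t * D `^ (- delta).

Let laplace_scaled (k : R) : 0 < k ->
  (\int[leb]_(s in I) (e s * expR (- (k * (s / D))))%:E)%E =
  (expR (- (tau * k `^ delta)))%:E.
Proof.
move=> k0; rewrite -[RHS](_ : (expR (- (t * (k / D) `^ delta)))%:E = _).
  rewrite -e_laplace ?divr_gt0//; apply: eq_integral => s _.
  by rewrite mulrCA.
rewrite powRM ?invr_ge0 ?(ltW k0) ?(ltW D0)//.
by rewrite /tau -powR_inv1 ?(ltW D0)// -powRrM mulN1r -mulrA [_ `^ delta * _]mulrC.
Qed.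

Let exp_scaled_meas (k : R) : measurable_fun [set: R] (fun s => expR (- (k * (s / D)))).
Proof.
have -> : (fun s => expR (- (k * (s / D)))) = (fun s => expR (- (s * (k / D)))).
  by apply/funext => s; rewrite mulrCA.
exact: expR_meas.
Qed.

Let e_exp_ge0 (k s : R) : I s -> (0 <= (e s * expR (- (k * (s / D))))%:E)%E.
Proof. by move=> /I_gt0 s0; rewrite lee_fin mulr_ge0 ?expR_ge0 ?e_ge0. Qed.

(** The integral of 1 - exp (- s / D) against the density is at most
    1 - exp (- tau), hence at most tau. *)
Lemma subordinator_integral_le (K : R) (phi : R -> R) : 0 <= K ->
  (forall u, 0 < u -> 0 <= phi u <= K * (1 - expR (- u))) ->
  (\int[leb]_(s in I) (e s * phi (s / D))%:E <= (K * tau)%:E)%E.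
Proof.
move=> K0 hphi.
pose h s : R := e s * (1 - expR (- (1 * (s / D)))).
have h0 s : I s -> (0 <= (h s)%:E)%E.
  move=> /I_gt0 s0; rewrite lee_fin mulr_ge0 ?e_ge0// subr_ge0 mul1r -expR0.
  by rewrite ler_expR oppr_le0 divr_ge0 ?ltW.
have mh : measurable_fun I (fun s => (h s)%:E).
  by apply: eM_meas; apply: measurable_funB.
apply: (@le_trans _ _ (K%:E * \int[leb]_(s in I) (h s)%:E)%E).
  rewrite -ge0_integralZl_EFin//.
  apply: ge0_le_integral_nomeas => s /I_gt0 s0.
    by rewrite lee_fin mulr_ge0 ?e_ge0//; have /andP[] := hphi _ (divr_gt0 s0 D0).
  rewrite -EFinM lee_fin /h mulrCA ler_wpM2l ?e_ge0// mul1r.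
  by have /andP[] := hphi _ (divr_gt0 s0 D0).
rewrite EFinM lee_wpmul2l ?lee_fin//.
have hs : (\int[leb]_(s in I) (h s)%:E + (expR (- tau))%:E <= 1)%E.
  have := laplace_scaled _ ltr01; rewrite powR1 /= mulr1 => <-.
  rewrite -ge0_integralD//; last exact: eM_meas.
    apply: le_trans subordinator_mass_le1; rewrite le_eqVlt; apply/orP; left; apply/eqP.
    by apply: eq_integral => s _; rewrite -EFinD /h -mulrDr subrK mulr1.
  by move=> s; exact: e_exp_ge0.
have : (\int[leb]_(s in I) (h s)%:E <= (1 - expR (- tau))%:E)%E.
  by rewrite EFinB leeBrDr.
move/le_trans; apply; rewrite lee_fin.
by have := expR_ge1Dx (- tau); lra.
Qed.

(** The integral of [laplace_test] at s / D is computed from the Laplace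
    transform at 1 / D, 2 / D and 4 / D.  The bound is useful when tau is small:
    it is then linear in tau. *)
Lemma subordinator_integral_ge (A k : R) (phi : R -> R) :
  0 <= k -> 1 < 2 `^ delta -> 2 `^ delta < A -> A < 2 ->
  (forall u, 0 < u -> 0 <= phi u) ->
  (forall u, 0 < u -> k * laplace_test A u <= phi u) ->
  ((k * (tau * ((2 `^ delta - 1) * (A - 2 `^ delta) -
           (1 + A) * (2 `^ delta) ^+ 2 * tau)))%:E <=
   \int[leb]_(s in I) (e s * phi (s / D))%:E)%E.
Proof.
move=> k0 y1 yA A2 phi0 hphi.
have A0 : 0 <= A by lra.
have A10 : 0 <= 1 + A by lra.
have gt20 : 0 < 2 :> R by lra.
have gt40 : 0 < 4 :> R by lra.
have y4 : (4 : R) `^ delta = (2 `^ delta) ^+ 2.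
  have -> : (4 : R) = 2 * 2 by lra.
  by rewrite powRM ?(ltW gt20)// expr2.
(* The positive part of the test function stands for phi: it is measurable,
   and nonnegative so that integrals can be added. *)
pose psi u := Num.max (laplace_test A u) 0.
have psi_meas : measurable_fun [set: R] (fun s => psi (s / D)).
  apply: measurable_maxr; last exact: measurable_cst.
  apply: measurable_funD; last exact: exp_scaled_meas.
  apply: measurable_funB; apply: measurable_funM => //.
have psi0 u : 0 <= psi u by rewrite /psi le_max lexx orbT.
have mP : measurable_fun I (fun s => (e s * psi (s / D))%:E) by exact: eM_meas.
have eP s : I s -> (0 <= (e s * psi (s / D))%:E)%E.
  by move=> /I_gt0 s0; rewrite lee_fin mulr_ge0 ?e_ge0.
apply: (@le_trans _ _ (k%:E * \int[leb]_(s in I) (e s * psi (s / D))%:E)%E); last first.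
  rewrite -ge0_integralZl_EFin//.
  apply: ge0_le_integral_nomeas => s Is; first by apply: mule_ge0; [rewrite lee_fin|exact: eP].
  have s0 := I_gt0 _ Is; have u0 := divr_gt0 s0 D0.
  rewrite -EFinM lee_fin mulrCA ler_wpM2l ?e_ge0// /psi.
  have := hphi _ u0; have := phi0 _ u0.
  by case: (leP (laplace_test A (s / D)) 0) => // _; rewrite mulr0.
rewrite EFinM lee_wpmul2l ?lee_fin//.
have tau0 : 0 <= tau by rewrite /tau mulr_ge0 ?powR_ge0 ?ltW.
have := laplace_test_exponents _ _ _ y1 yA A2 tau0.
set y := 2 `^ delta in y4 * => hy.
have L1 := laplace_scaled _ ltr01.
have L2 := laplace_scaled _ gt20.
have L4 := laplace_scaled _ gt40.
rewrite powR1 /= mulr1 in L1; rewrite -/y in L2; rewrite y4 in L4.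
have mE l : measurable_fun I (fun s => (e s * expR (- (l * (s / D))))%:E).
  exact: eM_meas.
(* The negative term of the test function is moved to the other side, to
   integrate nonnegative functions only. *)
have : ((A * expR (- tau) + expR (- (tau * y ^+ 2)))%:E <=
   \int[leb]_(s in I) (e s * psi (s / D))%:E +
   ((1 + A) * expR (- (tau * y)))%:E)%E.
  rewrite EFinD !EFinM -L1 -L2 -L4.
  rewrite -!ge0_integralZl_EFin//; first last.
  - exact: mE.
  - by move=> s; exact: e_exp_ge0.
  - exact: mE.
  - by move=> s; exact: e_exp_ge0.
  rewrite -!ge0_integralD//; first last.
  - exact: mE.
  - by move=> s; exact: e_exp_ge0.
  - by apply: measurable_funeM; exact: mE.
  - by move=> s Is; apply: mule_ge0; [rewrite lee_fin|exact: e_exp_ge0].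
  - by apply: measurable_funeM; exact: mE.
  - by move=> s Is; apply: mule_ge0; [rewrite lee_fin|exact: e_exp_ge0].
  apply: ge0_le_integral_nomeas => s Is.
    by apply: adde_ge0; [apply: mule_ge0; [rewrite lee_fin|]|]; rewrite ?e_exp_ge0.
  have s0 := I_gt0 _ Is.
  rewrite -!EFinM -!EFinD lee_fin [A * _]mulrCA [(1 + A) * _]mulrCA -!mulrDr ler_wpM2l ?e_ge0//.
  have : laplace_test A (s / D) <= psi (s / D) by rewrite /psi le_max lexx.
  by rewrite /laplace_test mul1r; lra.
rewrite -leeBlDr// -EFinB; apply: le_trans; rewrite lee_fin.
by move: hy; lra.
Qed.

End subordinator.

(** * Metric spaces with relatively compact balls *)

Lemma continuous_powR_gt0 (R : realType) (a x : R) : 0 < x ->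
  {for x, continuous (fun y : R => y `^ a)}.
Proof.
move=> x0; apply/differentiable_continuous/derivable1_diffP.
by apply: derivable_powR; rewrite in_itv/= x0.
Qed.

Section metric.
Context {R : realType} {X : metricType R}.

Lemma metric_ball_open (x : X) (r : R) : open (ball x r).
Proof.
rewrite openE => y; rewrite ballEmdist/= => xy.
apply/nbhs_ballP; exists (r - mdist x y) => /=; first by rewrite subr_gt0.
move=> z; rewrite ballEmdist/= => yz.
by apply: le_lt_trans (metric_triangle x y z) _; lra.
Qed.

Lemma mdist_continuous : continuous (fun z : X * X => mdist z.1 z.2).
Proof.
move=> [x y]; apply/cvgrPdist_lt => /= eps eps0.
exists (ball x (eps / 2), ball y (eps / 2)) => /=.
  by split; apply: nbhsx_ballx; rewrite divr_gt0.
move=> [x' y'] /= []; rewrite !ballEmdist/= => xx' yy'.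
have h1 := metric_triangle x x' y; have h2 := metric_triangle x' y' y.
have h3 := metric_triangle x' x y'; have h4 := metric_triangle x y y'.
rewrite (metric_sym y' y) in h2; rewrite (metric_sym x' x) in h3.
by rewrite ltr_norml; apply/andP; split; lra.
Qed.

End metric.

Section borel_metric.
Context {R : realType} {d : measure_display} {X : borelMetricType R d}.

Lemma open_borel_measurable (U : set X) : open U -> measurable U.
Proof. by move=> oU; rewrite borel_measurableE; exact: sub_sigma_algebra. Qed.

Lemma continuous_borel_measurable (f : X -> R) : continuous f ->
  measurable_fun [set: X] f.
Proof.
move=> /continuousP cf; apply: (measurability _ (RGenOpens.measurableE R)).
move=> _ [_ [a [b ->] <-]]; rewrite setTI.
by apply/open_borel_measurable/cf/interval_open.
Qed.

Lemma mdist_fst_continuous (z : X) : continuous (fun x : X => mdist x z).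
Proof.
move=> x; apply: (@continuous_comp _ _ _ (fun x => (x, z)) (fun w => mdist w.1 w.2)).
  by apply: cvg_pair; [exact: cvg_id|exact: cvg_cst].
exact: mdist_continuous.
Qed.

(** The balls of integer radius around a point cover the space, and each of
    them has finite 1/(k+1)-nets by compactness. *)
Lemma separable_of_compact_balls : balls_relatively_compact (X := X) ->
  exists2 S : set X, countable S &
    forall (x : X) (eps : R), 0 < eps -> exists2 z, S z & mdist x z < eps.
Proof.
move=> A1.
pose x0 : X := point.
have fin_net (n k : nat) : exists D : set X, finite_set D /\
    forall x, ball x0 n%:R x -> exists2 z, D z & mdist x z < k.+1%:R^-1.
  have := A1 x0 n%:R; rewrite compact_cover.
  move=> /(_ X setT (fun z => ball z (k.+1%:R^-1)))[].
  - by move=> z _; exact: metric_ball_open.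
  - move=> z _; exists z => //; rewrite ballEmdist/= mdistxx.
    by rewrite invr_gt0.
  - move=> D _ cov; exists [set` D]; split; first exact: finite_fset.
    move=> x xb; have [z zD] := cov x (subset_closure xb).
    by rewrite ballEmdist/= metric_sym => ?; exists z.
have [net netP] := choice (fun nk : nat * nat => fin_net nk.1 nk.2).
exists (\bigcup_(nk in [set: nat * nat]) net nk).
  by apply: bigcup_countable => // nk _; exact/finite_set_countable/(netP nk).1.
move=> x eps eps0.
pose n := (Num.trunc (mdist x0 x)).+1.
have [k hk] : exists k : nat, k.+1%:R^-1 < eps.
  by have [k] := ltr_add_invr eps0; rewrite add0r => ?; exists k.
have xb : ball x0 n%:R x.
  by rewrite ballEmdist/= /n; exact: truncnS_gt.
have [z zD xz] := (netP (n, k)).2 x xb.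
by exists z; [exists (n, k)|exact: lt_trans xz hk].
Qed.

(** Measurability for the product of the Borel sigma-algebras, which requires
    separability: mdist x y < r if and only if mdist x z + mdist y z < r for some
    z in a countable dense set. *)
Lemma mdist_measurable : balls_relatively_compact (X := X) ->
  measurable_fun [set: X * X] (fun w => mdist w.1 w.2).
Proof.
move=> /separable_of_compact_balls[S cS dS].
apply: (measurability _ (RGenInftyO.measurableE R)).
move=> _ [_ [r ->] <-]; rewrite setTI.
rewrite [X in measurable X](_ : _ = \bigcup_(z in S)
    [set w : X * X | mdist w.1 z + mdist w.2 z < r]); last first.
  apply/seteqP; split => [[x y]|[x y] [z _]]; rewrite /= in_itv/=.
    move=> xyr.
    have [|z Sz xz] := dS x ((r - mdist x y) / 2).
      by rewrite divr_gt0// subr_gt0.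
    exists z => //=; have := metric_triangle y x z; rewrite (metric_sym y x).
    lra.
  move=> /=; apply: le_lt_trans; rewrite (metric_sym y z); exact: metric_triangle.
have mS (z : X) : measurable [set w : X * X | mdist w.1 z + mdist w.2 z < r].
  have mz : measurable_fun [set: X] (fun x => mdist x z).
    exact/continuous_borel_measurable/mdist_fst_continuous.
  have mD : measurable_fun [set: X * X] (fun w => mdist w.1 z + mdist w.2 z).
    by apply: measurable_funD; [exact: measurableT_comp mz _|exact: measurableT_comp mz _].
  rewrite [X in measurable X](_ : _ = setT `&`
      (fun w : X * X => mdist w.1 z + mdist w.2 z) @^-1` [set` `]-oo, r[]).
    exact: mD.
  by rewrite setTI; apply/seteqP; split => w /=; rewrite in_itv.
move/pfcard_geP: cS => [->|[f]]; first by rewrite bigcup_set0.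
have -> : S = f @` setT.
  by apply/seteqP; split => [z /(@surj _ _ _ _ f)//|_ [n _ <-]]; exact: funS.
by rewrite bigcup_image; apply: bigcupT_measurable => n; exact: mS.
Qed.

End borel_metric.

(** * Pointwise bounds for the heat kernel and the subordinated kernel *)

Section metric_measure.
Context {R : realType} {d : measure_display} {X : borelMetricType R d}.

Lemma ahlfors_regular_sigma_finite (mu : {measure set X -> \bar R}) (dH : R) :
  ahlfors_regular mu dH -> sigma_finite setT mu.
Proof.
move=> [c1 [c2 [_ _ A2]]].
exists (fun n => ball (point : X) n%:R).
  apply/seteqP; split => // x _; exists (Num.trunc (mdist point x)).+1 => //.
  by rewrite ballEmdist/=; exact: truncnS_gt.
move=> n; split; first by apply: open_borel_measurable; exact: metric_ball_open.
by have /andP[_] := A2 point n%:R (ler0n _ _); move/le_lt_trans; apply; rewrite ltry.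
Qed.

(** If f were negative at z, it would be negative on a product of two balls,
    which has positive measure. *)
Lemma ae_ge0_continuous_ge0 (mu : {sigma_finite_measure set X -> \bar R})
    (f : X * X -> R) (z : X * X) :
  full_support mu -> {for z, continuous f} ->
  (\forall w \ae (mu \x mu)%E, 0 <= f w) -> 0 <= f z.
Proof.
move=> mu_supp cf [N [mN muN0 sN]]; rewrite leNgt; apply/negP => fz0.
have : \forall w \near z, f w < 0 by exact: (cvgr_lt (f z) cf).
case: z cf fz0 => x y cf fxy0 [[A B] /= [/nbhs_ballP[r r0 rA] /nbhs_ballP[s s0 sB]] AB].
have mb (u : X) (e : R) : measurable (ball u e).
  by apply: open_borel_measurable; exact: metric_ball_open.
have pos (u : X) (e : R) : 0 < e -> (0 < mu (ball u e))%E.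
  move=> e0; apply: mu_supp; first exact: metric_ball_open.
  by exists u; rewrite ballEmdist/= mdistxx.
have : ((mu \x mu) (ball x r `*` ball y s) <= (mu \x mu) N)%E.
  apply: le_measure; rewrite ?inE//; first exact: measurableX.
  move=> w [/rA Aw /sB Bw]; apply: sN => /=.
  by apply/negP; rewrite -ltNge; exact: AB.
rewrite muN0 product_measure1E// leNgt => /negP; apply.
by rewrite mule_gt0 ?pos.
Qed.

(** Stated off the diagonal, where the distance is positive and its real powers
    are continuous whatever the exponent. *)
Lemma sub_gaussian_profile_continuous (dH dW c c' t : R) (z : X * X) :
  0 < t -> z.1 != z.2 ->
  {for z, continuous (fun w => sub_gaussian_profile dH dW c c' t w.1 w.2)}.
Proof.
move=> t0 z12; have d0 : 0 < mdist z.1 z.2 by rewrite mdist_gt0.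
have cd : (mdist w.1 w.2 `^ dW / t) `^ (dW - 1)^-1 @[w --> z] -->
          (mdist z.1 z.2 `^ dW / t) `^ (dW - 1)^-1.
  apply: (continuous_cvg _ (h := fun y : R => y `^ (dW - 1)^-1)).
    by apply: continuous_powR_gt0; rewrite divr_gt0 ?powR_gt0.
  apply: cvgM; last exact: cvg_cst.
  apply: (continuous_cvg _ (h := fun y : R => y `^ dW)).
    exact: continuous_powR_gt0.
  exact: mdist_continuous.
apply: cvgM; first exact: cvg_cst.
apply: (continuous_cvg _ (h := expR)); first exact: continuous_expR.
by apply: cvgM; [exact: cvg_cst|exact: cd].
Qed.

Lemma sub_gaussian_bounds_off_diagonal
    (mu : {sigma_finite_measure set X -> \bar R}) (pk : R -> X -> X -> R)
    (dH dW : R) :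
  full_support mu ->
  (forall t : R, 0 < t -> continuous (fun z : X * X => pk t z.1 z.2)) ->
  sub_gaussian_bounds mu pk dH dW ->
  exists c3 c4 c5 c6 : R, [/\ 0 < c3, 0 < c4, 0 < c5 & 0 < c6] /\
    forall (t : R) (x y : X), 0 < t -> x != y ->
      sub_gaussian_profile dH dW c5 c6 t x y <= pk t x y <=
      sub_gaussian_profile dH dW c3 c4 t x y.
Proof.
move=> mu_supp cpk [c3 [c4 [c5 [c6 [cs HK]]]]]; exists c3, c4, c5, c6; split=> //.
move=> t x y t0 xy; have [N [mN N0 sN]] := HK t t0.
rewrite -subr_ge0 -[X in _ && X]subr_ge0; apply/andP; split.
  apply: (ae_ge0_continuous_ge0 _ (fun w =>
    pk t w.1 w.2 - sub_gaussian_profile dH dW c5 c6 t w.1 w.2) (x, y) mu_supp).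
    by apply: cvgB; [exact: cpk|exact: sub_gaussian_profile_continuous].
  exists N; split => //; apply: subset_trans sN; apply: subsetC => w /= [h _].
  by rewrite subr_ge0.
apply: (ae_ge0_continuous_ge0 _ (fun w =>
  sub_gaussian_profile dH dW c3 c4 t w.1 w.2 - pk t w.1 w.2) (x, y) mu_supp).
  by apply: cvgB; [exact: sub_gaussian_profile_continuous|exact: cpk].
exists N; split => //; apply: subset_trans sN; apply: subsetC => w /= [_ h].
by rewrite subr_ge0.
Qed.

Lemma sub_gaussian_profileE (dH dW c c' t : R) (x y : X) :
  0 < t -> x != y -> let D := mdist x y `^ dW in
  sub_gaussian_profile dH dW c c' t x y =
  c * D `^ (- (dH / dW)) * stretched_profile (dH / dW) (dW - 1)^-1 c' (t / D).
Proof.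
move=> t0 xy; cbv zeta; set D := mdist x y `^ dW.
have D0 : 0 < D by rewrite /D powR_gt0// mdist_gt0.
rewrite /sub_gaussian_profile /stretched_profile -/D.
rewrite invf_div mulNr mulrA -[_ * _ * (t / D) `^ _]mulrA.
rewrite -powRM ?divr_ge0 ?(ltW t0) ?(ltW D0)//.
by rewrite mulrCA divff ?gt_eqF// mulr1.
Qed.

Section subordinated.
Variables (pk : R -> X -> X -> R) (dH dW delta : R) (eta : R -> R -> R).
Hypothesis dH0 : 0 < dH.
Hypothesis dW2 : 2 <= dW.
Hypothesis delta0 : 0 < delta.
Hypothesis delta1 : delta < 1.
Hypothesis eta_density : is_subordinator_density delta eta.

Let dW0 : 0 < dW. Proof. by apply: lt_le_trans dW2; lra. Qed.

Let dW_neq0 : dW != 0. Proof. by rewrite gt_eqF. Qed.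

Let a_gt0 : 0 < dH / dW. Proof. exact: divr_gt0. Qed.

Let b_gt0 : 0 < (dW - 1)^-1.
Proof. by rewrite invr_gt0 subr_gt0; apply: lt_le_trans dW2; lra. Qed.

Let scale (x y : X) : x != y ->
  (mdist x y `^ dW) `^ (- (dH / dW)) * (mdist x y `^ dW) `^ (- delta) =
  (mdist x y `^ (dH + delta * dW))^-1.
Proof.
move=> xy; rewrite -!powRrM -powRD; last first.
  by apply/implyP => _; rewrite gt_eqF// mdist_gt0.
by rewrite -powRN; congr (_ `^ _); field.
Qed.

(** By scaling, the integral is D ^ (- dH / dW) times that of the stretched
    profile at s / D, which [subordinator_integral_le] bounds by a multiple of
    t D ^ (- delta). *)
Lemma subordinated_kernel_le (c c' : R) : 0 < c -> 0 < c' ->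
  (forall (t : R) (x y : X), 0 < t -> x != y ->
     0 <= pk t x y <= sub_gaussian_profile dH dW c c' t x y) ->
  exists2 C : R, 0 < C & forall (t : R) (x y : X), 0 < t -> x != y ->
    (0 <= subordinated_kernel eta pk t x y <=
     (C * t / mdist x y `^ (dH + delta * dW))%:E)%E.
Proof.
move=> c0 c'0 hpk.
have [K K0 hK] := stretched_profile_le _ _ _ a_gt0 b_gt0 c'0.
exists (c * K); first exact: mulr_gt0.
move=> t x y t0 xy; have [ec e0 el] := eta_density t t0.
apply/andP; split.
  apply: integral_ge0 => s; rewrite /= in_itv/= andbT => s0.
  by rewrite lee_fin mulr_ge0 ?e0//; have /andP[] := hpk s x y s0 xy.
pose D := mdist x y `^ dW; have D0 : 0 < D by rewrite /D powR_gt0// mdist_gt0.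
pose M := c * D `^ (- (dH / dW)).
have M0 : 0 <= M by rewrite /M mulr_ge0 ?powR_ge0 ?ltW.
apply: (@le_trans _ _ (\int[lebesgue_measure]_(s in `]0%R, +oo[%classic)
    (eta t s * (M * stretched_profile (dH / dW) (dW - 1)^-1 c' (s / D)))%:E)%E).
  apply: ge0_le_integral_nomeas => s; rewrite /= in_itv/= andbT => s0.
    by rewrite lee_fin mulr_ge0 ?e0//; have /andP[] := hpk s x y s0 xy.
  rewrite lee_fin ler_wpM2l ?e0// /M -sub_gaussian_profileE//.
  by have /andP[] := hpk s x y s0 xy.
apply: (le_trans (subordinator_integral_le t0 ec e0 el _ D0 (M * K)
  (fun u => M * stretched_profile (dH / dW) (dW - 1)^-1 c' u) _ _)).
- by rewrite mulr_ge0 // ltW.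
- move=> u u0; rewrite mulr_ge0 ?stretched_profile_ge0//=.
  by rewrite -mulrA ler_wpM2l// hK.
rewrite lee_fin -scale// /M -/D.
set P := D `^ (- (dH / dW)); set Q := D `^ (- delta).
by have -> : c * P * K * (t * Q) = c * K * t * (P * Q) by ring.
Qed.

(** As y = 2 ^ delta < 2, some A lies strictly between y and 2.  The condition
    on t says that tau = t D ^ (- delta) is small enough for the linear term
    g tau, with g = (y - 1) (A - y), to be at least twice the quadratic term
    b tau ^ 2 of [subordinator_integral_ge]. *)
Lemma subordinated_kernel_ge (c c' : R) : 0 < c -> 0 < c' ->
  (forall (t : R) (x y : X), 0 < t -> x != y ->
     sub_gaussian_profile dH dW c c' t x y <= pk t x y) ->
  exists C tau0 : R, [/\ 0 < C, 0 < tau0 &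
    forall (t : R) (x y : X), 0 < t -> x != y ->
      t <= tau0 * mdist x y `^ (delta * dW) ->
      ((C * t / mdist x y `^ (dH + delta * dW))%:E <=
       subordinated_kernel eta pk t x y)%E].
Proof.
move=> c0 c'0 hpk; pose y2 : R := 2 `^ delta.
have y2_gt1 : 1 < y2.
  by rewrite -(powRr0 2) /y2 /powR pnatr_eq0/= ltr_expR ltr_pM2r// ln_gt0//; lra.
have y2_lt2 : y2 < 2.
  rewrite -[ltRHS](powRr1 (ler0n R 2)) /y2 /powR pnatr_eq0/= ltr_expR ltr_pM2r//.
  by rewrite ln_gt0//; lra.
pose A := (2 + y2) / 2; have A_gt : y2 < A by rewrite /A; lra.
have A_lt2 : A < 2 by rewrite /A; lra.
have A_gt1 : 1 < A < 2 by rewrite A_lt2 andbT; lra.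
have [K K0 hK] := laplace_test_le _ _ _ _ a_gt0 b_gt0 c'0 A_gt1.
pose g := (y2 - 1) * (A - y2).
have g0 : 0 < g by rewrite /g mulr_gt0 ?subr_gt0.
pose b := (1 + A) * y2 ^+ 2.
have b0 : 0 < b by rewrite /b mulr_gt0 ?exprn_gt0//; lra.
exists (c / K * (g / 2)), (g / (2 * b)); split.
- by apply: mulr_gt0; apply: divr_gt0; rewrite // ltr0n.
- by apply: divr_gt0; rewrite // mulr_gt0// ltr0n.
move=> t x y t0 xy htau; have [ec e0 el] := eta_density t t0.
pose D := mdist x y `^ dW; have D0 : 0 < D by rewrite /D powR_gt0// mdist_gt0.
pose M := c * D `^ (- (dH / dW)).
have M0 : 0 <= M by rewrite /M mulr_ge0 ?powR_ge0 ?ltW.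
apply: (@le_trans _ _ (\int[lebesgue_measure]_(s in `]0%R, +oo[%classic)
    (eta t s * (M * stretched_profile (dH / dW) (dW - 1)^-1 c' (s / D)))%:E)%E);
  last first.
  apply: ge0_le_integral_nomeas => s; rewrite /= in_itv/= andbT => s0.
    by rewrite lee_fin mulr_ge0 ?e0// mulr_ge0 ?stretched_profile_ge0.
  by rewrite lee_fin ler_wpM2l ?e0// /M -sub_gaussian_profileE// hpk.
have MK0 : 0 <= M / K by rewrite divr_ge0// ltW.
apply: le_trans (subordinator_integral_ge t0 ec e0 el _ D0 A (M / K)
  (fun u => M * stretched_profile (dH / dW) (dW - 1)^-1 c' u) MK0
  y2_gt1 A_gt A_lt2 _ _); last 2 first.
- by move=> u u0; rewrite mulr_ge0 ?stretched_profile_ge0.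
- move=> u u0.
  by rewrite -(mulrA M) ler_wpM2l// mulrC ler_pdivrMr// mulrC hK.
rewrite lee_fin -/y2 -/g -/b -scale//.
set Q := D `^ (- delta); set P := D `^ (- (dH / dW)).
have tQ : t * Q <= g / (2 * b).
  by rewrite /Q powRN ler_pdivrMr ?(powR_gt0 delta D0)// /D -powRrM [dW * _]mulrC.
have Q0 : 0 <= t * Q by rewrite mulr_ge0 ?powR_ge0 ?(ltW t0).
have -> : c / K * (g / 2) * t * (P * Q) = M / K * (t * Q * (g / 2)).
  by rewrite /M -/P; ring.
rewrite ler_wpM2l// ler_wpM2l//.
move: tQ; rewrite ler_pdivlMr ?mulr_gt0//; lra.
Qed.

End subordinated.

End metric_measure.

(** * Comparison of the Besov and Sobolev seminorms *)

Section besov_sobolev.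
Context {R : realType} {d : measure_display} {X : borelMetricType R d}.
Variables (mu : {sigma_finite_measure set X -> \bar R}) (q : R -> X -> X -> \bar R).
Variables (dH lam p theta c C tau0 : R).
Hypothesis A1 : balls_relatively_compact (X := X).
Hypothesis p_ge1 : 1 <= p.
Hypothesis c_gt0 : 0 < c.
Hypothesis C_gt0 : 0 < C.
Hypothesis tau0_gt0 : 0 < tau0.
Hypothesis q_le : forall (t : R) (x y : X), 0 < t -> x != y ->
  (0 <= q t x y <= (C * t / mdist x y `^ (dH + lam * p))%:E)%E.
Hypothesis q_ge : forall (t : R) (x y : X), 0 < t -> x != y ->
  t <= tau0 * mdist x y `^ theta ->
  ((c * t / mdist x y `^ (dH + lam * p))%:E <= q t x y)%E.

Let p_gt0 : 0 < p. Proof. exact: lt_le_trans p_ge1. Qed.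
Let p_neq0 : p != 0. Proof. by rewrite gt_eqF. Qed.

Variable f : X -> R.
Hypothesis mf : measurable_fun setT f.

Let G (w : X * X) : R := `|f w.1 - f w.2| `^ p / mdist w.1 w.2 `^ (dH + lam * p).

Let S : \bar R := (\int[mu]_x \int[mu]_y (G (x, y))%:E)%E.

Let I (t : R) : \bar R :=
  (\int[mu]_y \int[mu]_x ((`|f x - f y| `^ p)%:E * q t x y))%E.

(** The part of the Sobolev integrand where the lower bound for the kernel at
    time t is available. *)
Let Gt (t : R) (w : X * X) : R :=
  if t <= tau0 * mdist w.1 w.2 `^ theta then G w else 0.

Let G_ge0 w : 0 <= G w. Proof. by rewrite /G divr_ge0 ?powR_ge0. Qed.

Let Gt_ge0 t w : 0 <= Gt t w.
Proof. by rewrite /Gt; case: ifP. Qed.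

Let G_diag x : G (x, x) = 0.
Proof. by rewrite /G/= subrr normr0 powR0 ?mul0r. Qed.

Let mdist_powR_measurable s : measurable_fun [set: X * X]
  (fun w => mdist w.1 w.2 `^ s).
Proof.
exact: (measurableT_comp (measurable_powR s) (mdist_measurable A1)).
Qed.

Let G_measurable : measurable_fun setT G.
Proof.
have mfst : measurable_fun [set: X * X] (fun w => f w.1) by exact: measurableT_comp mf _.
have msnd : measurable_fun [set: X * X] (fun w => f w.2) by exact: measurableT_comp mf _.
apply: measurable_funM.
  apply: (measurableT_comp (measurable_powR p)).
  by apply: measurableT_comp => //; exact: measurable_funB.
have -> : (fun w : X * X => (mdist w.1 w.2 `^ (dH + lam * p))^-1) =
          (fun w => mdist w.1 w.2 `^ (- (dH + lam * p))).
  by apply/funext => w; rewrite powRN.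
exact: mdist_powR_measurable.
Qed.

Let Gt_measurable t : measurable_fun setT (Gt t).
Proof.
apply: measurable_fun_ifT => //.
apply: measurable_fun_ler; first exact: measurable_cst.
by apply: measurable_funM; [exact: measurable_cst|exact: mdist_powR_measurable].
Qed.

Let section_measurable (H : X * X -> R) x : measurable_fun setT H ->
  measurable_fun [set: X] (fun y => (H (x, y))%:E).
Proof.
by move=> mH; apply/measurable_EFinP; exact: measurableT_comp mH (pair1_measurable x).
Qed.

Let partial_integral_measurable (H : X * X -> R) : measurable_fun setT H ->
  (forall w, 0 <= H w) ->
  measurable_fun [set: X] (fun x => \int[mu]_y (H (x, y))%:E)%E.
Proof.
move=> mH H0.
by apply: (measurable_fun_fubini_tonelli_F (fun w => (H w)%:E)) => //;
  exact/measurable_EFinP.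
Qed.

Let integral_ge0' (H : X * X -> R) x : (forall w, 0 <= H w) ->
  (0 <= \int[mu]_y (H (x, y))%:E)%E.
Proof. by move=> H0; apply: integral_ge0 => y _; rewrite lee_fin. Qed.

Let iterated_integralZl k (H : X * X -> R) : 0 <= k -> measurable_fun setT H ->
  (forall w, 0 <= H w) ->
  (\int[mu]_x \int[mu]_y (k * H (x, y))%:E =
   k%:E * \int[mu]_x \int[mu]_y (H (x, y))%:E)%E.
Proof.
move=> k0 mH H0.
under eq_integral => x _.
  under eq_integral do rewrite EFinM.
  rewrite ge0_integralZl_EFin//; [|by move=> y _; rewrite lee_fin|exact: section_measurable].
  over.
rewrite ge0_integralZl_EFin//; first by move=> x _; exact: integral_ge0'.
exact: partial_integral_measurable.
Qed.

(** The outer variable is y on the Besov side and x on the Sobolev side; as G is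
    symmetric, renaming the variables matches the two iterated integrals. *)
Let besov_integral_le t : 0 < t -> (I t <= (C * t)%:E * S)%E.
Proof.
move=> t0; rewrite -iterated_integralZl ?mulr_ge0 ?(ltW C_gt0) ?(ltW t0)//.
have h y x : (0 <= (`|f x - f y| `^ p)%:E * q t x y <= (C * t * G (y, x))%:E)%E.
  have [->|xy] := eqVneq x y.
    by rewrite G_diag subrr normr0 powR0// mul0e mulr0 lexx.
  have /andP[q0 q1] := q_le t x y t0 xy.
  apply/andP; split; first by apply: mule_ge0; rewrite // lee_fin powR_ge0.
  have -> : C * t * G (y, x) = `|f x - f y| `^ p * (C * t / mdist x y `^ (dH + lam * p)).
    by rewrite /G/= distrC (metric_sym y x) mulrCA.
  by rewrite EFinM; apply: lee_wpmul2l => //; rewrite lee_fin powR_ge0.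
apply: ge0_le_integral_nomeas => y _.
  by apply: integral_ge0 => x _; have /andP[] := h y x.
by apply: ge0_le_integral_nomeas => x _; have /andP[] := h y x.
Qed.

Let besov_integral_ge t : 0 < t ->
  ((c * t)%:E * \int[mu]_x \int[mu]_y (Gt t (x, y))%:E <= I t)%E.
Proof.
move=> t0; rewrite -iterated_integralZl ?mulr_ge0 ?(ltW c_gt0) ?(ltW t0)//.
have h y x : ((c * t * Gt t (y, x))%:E <= (`|f x - f y| `^ p)%:E * q t x y)%E.
  have [->|xy] := eqVneq x y.
    rewrite subrr normr0 powR0// mul0e /Gt G_diag.
    by case: ifP; rewrite mulr0.
  have q0 : (0 <= (`|f x - f y| `^ p)%:E * q t x y)%E.
    have /andP[q0 _] := q_le t x y t0 xy.
    by apply: mule_ge0; rewrite // lee_fin powR_ge0.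
  rewrite /Gt; case: ifP => [/= tle|_]; last by rewrite mulr0.
  rewrite metric_sym in tle.
  have -> : c * t * G (y, x) = `|f x - f y| `^ p * (c * t / mdist x y `^ (dH + lam * p)).
    by rewrite /G/= distrC (metric_sym y x) mulrCA.
  by rewrite EFinM; apply: lee_wpmul2l; [rewrite lee_fin powR_ge0|exact: q_ge].
have h0 y x : (0 <= (c * t * Gt t (y, x))%:E)%E.
  by rewrite lee_fin mulr_ge0// mulr_ge0 ?ltW.
apply: ge0_le_integral_nomeas => y _; first by apply: integral_ge0 => x _.
by apply: ge0_le_integral_nomeas => x _.
Qed.

Let tn (n : nat) : R := n.+1%:R^-1.

Let tn_gt0 n : 0 < tn n. Proof. by rewrite invr_gt0. Qed.

Let Gt_nd w : nondecreasing_seq (fun n => (Gt (tn n) w)%:E).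
Proof.
move=> m n mn; rewrite lee_fin /Gt.
case: ifP => [hm|_]; last by case: ifP.
have -> // : tn n <= tau0 * mdist w.1 w.2 `^ theta.
by apply: le_trans hm; rewrite lef_pV2 ?posrE// ler_nat.
Qed.

(** On the diagonal G vanishes; off the diagonal the sequence is eventually
    constant. *)
Let Gt_cvg w : (Gt (tn n) w)%:E @[n --> \oo] --> (G w)%:E.
Proof.
have [e|xy] := eqVneq w.1 w.2.
  have Gw : G w = 0 by case: w e => x y /= ->.
  have -> : (fun n => (Gt (tn n) w)%:E) = (fun=> (G w)%:E).
    by apply/funext => n; rewrite /Gt Gw if_same.
  exact: cvg_cst.
apply: cvg_near_cst.
have d0 : 0 < tau0 * mdist w.1 w.2 `^ theta.
  by rewrite mulr_gt0// powR_gt0// mdist_gt0.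
have [k] := ltr_add_invr d0; rewrite add0r => hk.
exists k => // n /= kn; rewrite /Gt ifT//.
by apply: le_trans (ltW hk); rewrite lef_pV2 ?posrE// ler_nat ltnS.
Qed.

(** Monotone convergence, applied first to the inner integral and then to the
    outer one. *)
Let truncated_cvg :
  (\int[mu]_x \int[mu]_y (Gt (tn n) (x, y))%:E @[n --> \oo] --> S)%E.
Proof.
have inner x : (\int[mu]_y (Gt (tn n) (x, y))%:E @[n --> \oo] -->
                \int[mu]_y (G (x, y))%:E)%E.
  have -> : (\int[mu]_y (G (x, y))%:E =
             \int[mu]_y (limn (fun n => (Gt (tn n) (x, y))%:E)))%E.
    by apply: eq_integral => y _; apply/esym/cvg_lim => //; exact: Gt_cvg.
  apply: cvg_monotone_convergence => //.
  - by move=> n; exact: section_measurable.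
  - by move=> n y _; rewrite lee_fin.
have -> : S = (\int[mu]_x limn (fun n => \int[mu]_y (Gt (tn n) (x, y))%:E))%E.
  by apply: eq_integral => x _; apply/esym/cvg_lim => //; exact: inner.
apply: cvg_monotone_convergence => //.
- by move=> n; exact: partial_integral_measurable.
- by move=> n x _; exact: integral_ge0'.
- move=> x _ m n mn; apply: ge0_le_integral_nomeas => y _; first by rewrite lee_fin.
  exact: (Gt_nd (x, y) m n mn).
Qed.

Let S_ge0 : (0 <= S)%E.
Proof. by apply: integral_ge0 => x _; exact: integral_ge0'. Qed.

Let B := besov_seminorm mu q p p^-1 f.

Let B_ge t : 0 < t -> ((t `^ (- p^-1))%:E * I t `^ p^-1 <= B)%E.
Proof. by move=> t0; apply: ereal_sup_ubound; exists t. Qed.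

Let B_ge0 : (0 <= B)%E.
Proof.
apply: le_trans (B_ge _ ltr01); apply: mule_ge0; last exact: poweR_ge0.
by rewrite lee_fin powR_ge0.
Qed.

Let I_ge0 t : 0 < t -> (0 <= I t)%E.
Proof.
move=> t0; apply: integral_ge0 => y _; apply: integral_ge0 => x _.
have [->|xy] := eqVneq x y; first by rewrite subrr normr0 powR0// mul0e.
have /andP[q0 _] := q_le t x y t0 xy.
by apply: mule_ge0; rewrite // lee_fin powR_ge0.
Qed.

Let sobolevE : sobolev_seminorm mu dH lam p f = (S `^ p^-1)%E.
Proof. by []. Qed.

Let time_factor t : 0 < t -> (t `^ (- p^-1)) = t^-1 `^ p^-1.
Proof. by move=> t0; rewrite -[t^-1]powR_inv1 ?(ltW t0)// -powRrM mulN1r. Qed.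

Lemma besov_seminorm_le :
  (besov_seminorm mu q p p^-1 f <= (C `^ p^-1)%:E * sobolev_seminorm mu dH lam p f)%E.
Proof.
have V0 : 0 <= p^-1 by rewrite invr_ge0 ltW.
rewrite sobolevE; apply: ge_ereal_sup => _ [t /= t0 <-]; rewrite -/(I t).
have tV0 : 0 <= t^-1 by rewrite invr_ge0 ltW.
rewrite time_factor// -poweR_EFin -poweR_EFin.
rewrite -[leLHS]poweRM ?lee_fin ?I_ge0//.
rewrite -[leRHS]poweRM ?lee_fin ?(ltW C_gt0)//.
apply: gt0_ler_poweR => //.
- by rewrite in_itv/= leey andbT mule_ge0 ?I_ge0 ?lee_fin.
- by rewrite in_itv/= leey andbT mule_ge0 ?lee_fin// ltW.
apply: (@le_trans _ _ ((t^-1)%:E * ((C * t)%:E * S))%E).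
  by apply: lee_wpmul2l; [rewrite lee_fin|exact: besov_integral_le].
by rewrite muleA -EFinM mulrCA mulVf ?gt_eqF// mulr1.
Qed.

(** Each truncated Sobolev energy at time t is at most c^-1 t^-1 I t, and t^-1 I t
    is at most the p-th power of the Besov seminorm. *)
Lemma besov_seminorm_ge :
  ((c `^ p^-1)%:E * sobolev_seminorm mu dH lam p f <= besov_seminorm mu q p p^-1 f)%E.
Proof.
have V0 : 0 <= p^-1 by rewrite invr_ge0 ltW.
rewrite sobolevE -/B -poweR_EFin -poweRM ?lee_fin ?(ltW c_gt0)//.
suff cS : (c%:E * S <= B `^ p)%E.
  have -> : B = ((B `^ p) `^ p^-1)%E by rewrite -poweRrM divff// poweRe1.
  apply: gt0_ler_poweR => //.
    by rewrite in_itv/= leey andbT mule_ge0 ?lee_fin// ltW.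
  by rewrite in_itv/= leey andbT poweR_ge0.
rewrite -lee_pdivlMl//; apply: (cvge_le _ truncated_cvg); apply: nearW => n.
rewrite lee_pdivlMl//.
have t0 := tn_gt0 n; set t := tn n in t0 *.
have tV0 : 0 <= t^-1 by rewrite invr_ge0 ltW.
apply: (@le_trans _ _ ((t^-1)%:E * I t)%E).
  by rewrite lee_pdivlMl// muleA -EFinM [t * c]mulrC; exact: besov_integral_ge.
have := B_ge _ t0; rewrite time_factor// -poweR_EFin -poweRM ?lee_fin ?I_ge0// => h.
have -> : ((t^-1)%:E * I t = (((t^-1)%:E * I t) `^ p^-1) `^ p)%E.
  by rewrite -poweRrM mulVf// poweRe1// mule_ge0 ?lee_fin ?I_ge0.
apply: gt0_ler_poweR => //; first exact: ltW.
  by rewrite in_itv/= leey andbT poweR_ge0.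
by rewrite in_itv/= leey andbT.
Qed.

End besov_sobolev.

Lemma sigma_finite_measure_of d (T : measurableType d) (R : realType)
    (mu : {measure set T -> \bar R}) : sigma_finite setT mu ->
  exists nu : {sigma_finite_measure set T -> \bar R},
    mu = (nu : {measure set T -> \bar R}).
Proof.
move=> sf.
pose m1 := isSFinite.Build _ _ _ _ (sfinite_measure_sigma_finite sf).
pose m2 := isSigmaFinite.Build _ _ _ _ sf.
pose nu := HB.pack_for (SigmaFiniteMeasure.type T R) (Measure.sort mu) m1 m2.
by exists nu; exact: eq_measure.
Qed.

Theorem proposition3p2 (R : realType) (d : measure_display)
    (X : borelMetricType R d) (mu : {measure set X -> \bar R})
    (F : set (X -> R)) (E : (X -> R) -> (X -> R) -> R)
    (P : R -> (X -> R) -> X -> R) (pk : R -> X -> X -> R)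
    (dH dW kappa delta p : R) (eta : R -> R -> R)
    (Xlc : locally_compact [set: X])
    (mu_radon : is_radon mu)
    (mu_supp : full_support mu)
    (E_dirichlet : is_dirichlet_form mu F E)
    (P_heat : is_heat_semigroup mu F E P)
    (A1 : balls_relatively_compact (X := X))
    (dH_gt0 : 0 < dH)
    (A2 : ahlfors_regular mu dH)
    (A3_regular : is_regular mu F E)
    (A3_local : is_strongly_local mu F E)
    (pk_kernel : is_continuous_heat_kernel mu pk P)
    (dW_ge2 : 2 <= dW)
    (HK : sub_gaussian_bounds mu pk dH dW)
    (kappa_crit : is_critical_kappa mu dW kappa)
    (BE : weak_bakry_emery mu pk dW kappa)
    (delta_gt0 : 0 < delta) (delta_lt1 : delta < 1)
    (eta_density : is_subordinator_density delta eta)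
    (p_ge1 : 1 <= p) :
  let q := subordinated_kernel eta pk in
  besov_space mu q p p^-1 = sobolev_space mu dH (delta * dW / p) p /\
  exists c C : R, [/\ 0 < c, 0 < C &
    forall f : X -> R, besov_space mu q p p^-1 f ->
      (c%:E * sobolev_seminorm mu dH (delta * dW / p) p f
         <= besov_seminorm mu q p p^-1 f
         <= C%:E * sobolev_seminorm mu dH (delta * dW / p) p f)%E].
Proof.
move=> q.
have sf := ahlfors_regular_sigma_finite mu dH A2.
have [nu munu] := sigma_finite_measure_of _ _ _ mu sf; subst mu.
have [c3 [c4 [c5 [c6 [[c30 c40 c50 c60] bounds]]]]] :=
  sub_gaussian_bounds_off_diagonal nu _ _ _ mu_supp pk_kernel.1 HK.
have p0 : 0 < p by exact: lt_le_trans p_ge1.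
have pk_upper t x y : 0 < t -> x != y ->
    0 <= pk t x y <= sub_gaussian_profile dH dW c3 c4 t x y.
  move=> t0 xy; have /andP[lo ->] := bounds t x y t0 xy; rewrite andbT.
  apply: le_trans lo; rewrite /sub_gaussian_profile.
  by rewrite !mulr_ge0 ?powR_ge0 ?expR_ge0// ltW.
have pk_lower t x y : 0 < t -> x != y ->
    sub_gaussian_profile dH dW c5 c6 t x y <= pk t x y.
  by move=> t0 xy; have /andP[] := bounds t x y t0 xy.
have [C C0 q_le] := subordinated_kernel_le pk dH dW delta eta
  dH_gt0 dW_ge2 eta_density c3 c4 c30 c40 pk_upper.
have [c [tau0 [c0 tau00 q_ge]]] := subordinated_kernel_ge pk dH dW delta eta
  dH_gt0 dW_ge2 delta_gt0 delta_lt1 eta_density c5 c6 c50 c60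
  pk_lower.
have lamE : dH + delta * dW = dH + delta * dW / p * p by rewrite divfK ?gt_eqF.
rewrite lamE in q_le q_ge.
have compare f : f \in Lfun nu p%:E ->
    ((c `^ p^-1)%:E * sobolev_seminorm nu dH (delta * dW / p) p f
       <= besov_seminorm nu q p p^-1 f
       <= (C `^ p^-1)%:E * sobolev_seminorm nu dH (delta * dW / p) p f)%E.
  rewrite inE => /andP[/[!inE] mf _]; apply/andP; split.
    exact: (besov_seminorm_ge nu q _ _ _ (delta * dW) c C tau0).
  exact: (besov_seminorm_le nu q _ _ _ C).
have cp0 : 0 < c `^ p^-1 by rewrite powR_gt0.
have Cp0 : 0 < C `^ p^-1 by rewrite powR_gt0.
split; last first.
  by exists (c `^ p^-1), (C `^ p^-1); split => // f [fL _]; exact: compare.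
apply/seteqP; split => f [fL fin]; split => //; have /andP[lo hi] := compare f fL.
  rewrite ltey; apply/eqP => foo; move: lo; rewrite foo gt0_muley ?lte_fin//.
  by rewrite leNgt fin.
apply: le_lt_trans hi _; rewrite ltey_eq; apply/orP; left.
rewrite fin_numM// ge0_fin_numE//; exact: poweR_ge0.
Qed.
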